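(* Let $A$ be a simple unital $C^*$-algebra, let $G$ be a finite group, and let $\alpha:G\to \mathrm{Aut}(A)$ be an action of $G$ on $A$. Then the following statements are equivalent: (1) $\alpha$ has the weak tracial Rokhlin property; (2) for every finite subset $F\subset A$, every $\varepsilon>0$ and every $x\in A_+\setminus\{0\}$, there exist mutually orthogonal positive contractions $f_g\in A$ ($g\in G$) such that, with $f=\sum_{g\in G}f_g$: (a) $\|f_ga-af_g\|<\varepsilon$ for all $g\in G$, $a\in F$; (b) $\|\alpha_g(f_h)-f_{gh}\|<\varepsilon$ for all $g,h\in G$; (c) $1-f\precsim x$; (d) $\|f\|>1-\varepsilon$; (3) for every finite subset $F\subset A$, every $\varepsilon>0$ and every $x\in A_+\setminus\{0\}$, there exist mutually orthogonal positive contractions $f_g\in A$ ($g\in G$) such that, with $f=\sum_{g\in G}f_g$: (a) $\|f_ga-af_g\|<\varepsilon$ for all $g\in G$, $a\in F$; (b) $\|\alpha_g(f_h)-f_{gh}\|<\varepsilon$ for all $g,h\in G$; (c) $1-f\precsim x$; (d) $\|faf\|>\|a\|-\varepsilon$ for all $a\in F$. Moreover, the same equivalence holds with ''weak tracial Rokhlin property'' replaced by ''tracial Rokhlin property'' and ''mutually orthogonal positive contractions'' replaced by ''mutually orthogonal projections'' in (2) and (3).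
   Context: For positive elements $a,b$ of a $C^*$-algebra $A$, $a\precsim b$ (Cuntz subequivalence) means there is a sequence $(v_n)$ in $A$ with $\|a-v_nbv_n^*\|\to 0$. An action $\alpha$ of a finite group $G$ on a simple unital $C^*$-algebra $A$ has the weak tracial Rokhlin property if for every finite subset $F\subset A$, every $\varepsilon>0$ and every $x\in A_+$ with $\|x\|=1$, there exist mutually orthogonal positive contractions $f_g\in A$ ($g\in G$), with $f=\sum_{g\in G}f_g$, such that: (a) $\|f_ga-af_g\|<\varepsilon$ for all $g\in G$, $a\in F$; (b) $\|\alpha_g(f_h)-f_{gh}\|<\varepsilon$ for all $g,h\in G$; (c) $1-f\precsim x$; (d) $\|fxf\|>1-\varepsilon$. It has the tracial Rokhlin property if the $f_g$ can moreover be chosen to be mutually orthogonal projections. *)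

(* Defs.v *)
(* (with mathcomp-analysis reals and real_closed complex numbers). *)
From HB Require Import structures.
From mathcomp Require Import all_boot all_order all_algebra all_fingroup.
From mathcomp Require Import reals.
From mathcomp.real_closed Require Import complex.
Set Implicit Arguments. Unset Strict Implicit. Unset Printing Implicit Defensive.
Import Order.TTheory GRing.Theory Num.Theory.
Local Open Scope ring_scope.

(* Throughout: R is the field of real numbers (a realType), the scalar field is
   the complex numbers R[i], and a (unital) C*-algebra is a unital complex
   algebra A (an algType over R[i]) together with an involution [st] and a
   norm [nrm : A -> R] satisfying the axioms below. *)

Section CStar.
Variables (R : realType) (A : algType R[i]) (st : A -> A) (nrm : A -> R).

(* Cauchy sequences and convergence w.r.t. nrm *)
Definition cauchy_seq (u : nat -> A) : Prop :=
  forall e : R, 0 < e -> exists N : nat, forall m n : nat,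
    (N <= m)%N -> (N <= n)%N -> nrm (u m - u n) < e.
Definition converges_to (u : nat -> A) (l : A) : Prop :=
  forall e : R, 0 < e -> exists N : nat, forall n : nat,
    (N <= n)%N -> nrm (u n - l) < e.

(* Axioms of a unital C*-algebra (unital Banach *-algebra with the C*-identity). *)
Definition unital_cstar_algebra : Prop :=
  (* involution *)
  (forall a b, st (a + b) = st a + st b) /\
  (forall (c : R[i]) a, st (c *: a) = (c^*)%R *: st a) /\
  (forall a b, st (a * b) = st b * st a) /\
  (forall a, st (st a) = a) /\
  (* norm *)
  (forall a, nrm a = 0 -> a = 0) /\
  (forall a b, nrm (a + b) <= nrm a + nrm b) /\
  (forall (c : R[i]) a, nrm (c *: a) = ComplexField.Normc.normc c * nrm a) /\
  (forall a b, nrm (a * b) <= nrm a * nrm b) /\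
  (* C*-identity *)
  (forall a, nrm (st a * a) = nrm a ^+ 2) /\
  (* completeness *)
  (forall u, cauchy_seq u -> exists l, converges_to u l).

(* closed two-sided ideals and simplicity *)
Definition closed_ideal (I : A -> Prop) : Prop :=
  [/\ I 0,
      (forall a b, I a -> I b -> I (a + b)),
      (forall (c : R[i]) a, I a -> I (c *: a)),
      (forall a b, I b -> I (a * b) /\ I (b * a)) &
      (forall u l, (forall n, I (u n)) -> converges_to u l -> I l)].

Definition simple_cstar : Prop :=
  forall I, closed_ideal I -> (forall a, I a -> a = 0) \/ (forall a, I a).

(* invertibility, spectrum, positivity *)
Definition invertible (a : A) : Prop := exists b, a * b = 1 /\ b * a = 1.

(* a is positive: self-adjoint with spectrum contained in [0, +oo) *)
Definition positive (a : A) : Prop :=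
  st a = a /\ (forall lam : R[i], ~ (0 <= lam) -> invertible (a - lam *: 1)).

Definition pos_contraction (a : A) : Prop := positive a /\ nrm a <= 1.
Definition projection (p : A) : Prop := st p = p /\ p * p = p.

(* Cuntz subequivalence a ≾ b *)
Definition cuntz_below (a b : A) : Prop :=
  exists v : nat -> A, converges_to (fun n => v n * b * st (v n)) a.

(* *-automorphisms and actions of a finite group *)
Definition star_automorphism (phi : A -> A) : Prop :=
  bijective phi /\
  (forall a b, phi (a + b) = phi a + phi b) /\
  (forall (c : R[i]) a, phi (c *: a) = c *: phi a) /\
  (forall a b, phi (a * b) = phi a * phi b) /\
  phi 1 = 1 /\
  (forall a, phi (st a) = st (phi a)).

Definition group_action (gT : finGroupType) (alpha : gT -> A -> A) : Prop :=
  [/\ (forall g, star_automorphism (alpha g)),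
      (forall a, alpha 1%g a = a) &
      (forall g h a, alpha (g * h)%g a = alpha g (alpha h a))].

(* Common part of the Rokhlin-type conditions: [elt] is the required kind of the
   tower elements (positive contractions, or projections). *)
Definition rokhlin_tower (gT : finGroupType) (alpha : gT -> A -> A)
    (elt : A -> Prop) (F : seq A) (eps : R) (x : A) (f : gT -> A) : Prop :=
  [/\ (forall g, elt (f g)),
      (forall g h, g != h -> f g * f h = 0),
      (forall g a, a \in F -> nrm (f g * a - a * f g) < eps),
      (forall g h, nrm (alpha g (f h) - f (g * h)%g) < eps) &
      cuntz_below (1 - \sum_(g : gT) f g) x].

(* Definition-style condition: x positive of norm one, (d) ||f x f|| > 1 - eps *)
Definition rokhlin_def (gT : finGroupType) (alpha : gT -> A -> A)
    (elt : A -> Prop) : Prop :=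
  forall (F : seq A) (eps : R) (x : A), 0 < eps -> positive x -> nrm x = 1 ->
    exists f : gT -> A, rokhlin_tower alpha elt F eps x f /\
      nrm ((\sum_(g : gT) f g) * x * (\sum_(g : gT) f g)) > 1 - eps.

Definition weak_tracial_rokhlin (gT : finGroupType) (alpha : gT -> A -> A) :=
  rokhlin_def alpha pos_contraction.
Definition tracial_rokhlin (gT : finGroupType) (alpha : gT -> A -> A) :=
  rokhlin_def alpha projection.

(* condition (2): x positive nonzero, (d) ||f|| > 1 - eps *)
Definition rokhlin_cond2 (gT : finGroupType) (alpha : gT -> A -> A)
    (elt : A -> Prop) : Prop :=
  forall (F : seq A) (eps : R) (x : A), 0 < eps -> positive x -> x <> 0 ->
    exists f : gT -> A, rokhlin_tower alpha elt F eps x f /\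
      nrm (\sum_(g : gT) f g) > 1 - eps.

(* condition (3): x positive nonzero, (d) ||f a f|| > ||a|| - eps for a in F *)
Definition rokhlin_cond3 (gT : finGroupType) (alpha : gT -> A -> A)
    (elt : A -> Prop) : Prop :=
  forall (F : seq A) (eps : R) (x : A), 0 < eps -> positive x -> x <> 0 ->
    exists f : gT -> A, rokhlin_tower alpha elt F eps x f /\
      (forall a, a \in F ->
         nrm ((\sum_(g : gT) f g) * a * (\sum_(g : gT) f g)) > nrm a - eps).

End CStar.

(* Main.v *)
(** Write [f] for the sum of the tower. Orthogonality gives [|f| <= 1], and after
    rescaling [x] only (2) => (3) has content. There it suffices that, for [|a| = 1],
    a self-adjoint contraction [f] of norm close to 1 which almost commutes with a
    suitable finite set satisfies [|f a f| > 1 - e].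
    Put [w = (a^* a)^2] and [n = 2^J]. Up to commutators,
    [((f a f)^* (f a f))^(2n)] is [w^n f^(8n)], so [|f a f|^(4n) |h|] almost dominates
    [|w^n h f^(8n)|] for every [h]. Choosing [h <> 0] in the spectral subspace
    [w >= 1 - e/2], the latter is at least [(1 - e/2)^n |h f^(8n)|]. By simplicity
    [sum c_i h d_i] is close to 1 for finitely many [c_i, d_i], so
    [|h f^(8n)| >= |f|^(8n) / M] with [M] independent of [n], and a large [n] excludes
    [|f a f| <= 1 - e]. *)
Require Import Defs.
From mathcomp Require Import all_boot all_order all_algebra all_fingroup.
From mathcomp Require Import reals.
From mathcomp.real_closed Require Import complex.
From mathcomp Require Import ring lra.

Section CStarAlgebra.
Set Implicit Arguments.
Unset Strict Implicit.
Import Order.TTheory GRing.Theory Num.Theory.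
Local Open Scope complex_scope.
Local Open Scope ring_scope.
Variables (R : realType) (A : algType R[i]) (st : A -> A) (nrm : A -> R).
Hypothesis HA : unital_cstar_algebra st nrm.
Implicit Types (a b c h q x y z : A) (r e d : R).

(** * Elementary consequences of the C*-algebra axioms *)

Lemma stD a b : st (a + b) = st a + st b.
Proof. by case: HA. Qed.

Lemma stZ (k : R[i]) a : st (k *: a) = (k^*)%R *: st a.
Proof. by case: HA => _ []. Qed.

Lemma stM a b : st (a * b) = st b * st a.
Proof. by case: HA => _ [_ []]. Qed.

Lemma stK a : st (st a) = a.
Proof. by case: HA => _ [_ [_ []]]. Qed.

Lemma nrm_eq0 a : nrm a = 0 -> a = 0.
Proof. by case: HA => _ [_ [_ [_ [H _]]]]; apply: H. Qed.

Lemma nrmD a b : nrm (a + b) <= nrm a + nrm b.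
Proof. by case: HA => _ [_ [_ [_ [_ [H _]]]]]. Qed.

Lemma nrmZC (k : R[i]) a : nrm (k *: a) = ComplexField.Normc.normc k * nrm a.
Proof. by case: HA => _ [_ [_ [_ [_ [_ [H _]]]]]]. Qed.

Lemma nrmM a b : nrm (a * b) <= nrm a * nrm b.
Proof. by case: HA => _ [_ [_ [_ [_ [_ [_ [H _]]]]]]]. Qed.

Lemma nrm_st_mul a : nrm (st a * a) = nrm a ^+ 2.
Proof. by case: HA => _ [_ [_ [_ [_ [_ [_ [_ [H _]]]]]]]]. Qed.

Lemma cauchy_converges u : cauchy_seq nrm u -> exists l, converges_to nrm u l.
Proof. by case: HA => _ [_ [_ [_ [_ [_ [_ [_ [_ H]]]]]]]]; apply: H. Qed.

Lemma nrmZ r a : nrm (r%:C *: a) = `|r| * nrm a.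
Proof. by rewrite nrmZC /= expr0n addr0 sqrtr_sqr. Qed.

Lemma stZr r a : st (r%:C *: a) = r%:C *: st a.
Proof. by rewrite stZ; congr (_ *: _); apply/eqP; rewrite eq_complex /= oppr0 !eqxx. Qed.

Lemma nrm0 : nrm 0 = 0.
Proof. by rewrite -(scale0r (0 : A)) -[0 in LHS]/(0%:C) nrmZ normr0 mul0r. Qed.

Lemma nrmN a : nrm (- a) = nrm a.
Proof.
have -> : - a = (-1)%:C *: a by rewrite rmorphN rmorph1 scaleN1r.
by rewrite nrmZ normrN1 mul1r.
Qed.

Lemma nrm_ge0 a : 0 <= nrm a.
Proof. by have := nrmD a (- a); rewrite subrr nrm0 nrmN; lra. Qed.

Lemma nrmB a b : nrm (a - b) <= nrm a + nrm b.
Proof. by rewrite -(nrmN b) nrmD. Qed.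

Lemma nrm_distC a b : nrm (a - b) = nrm (b - a).
Proof. by rewrite -nrmN opprB. Qed.

Lemma nrm_gt0 a : a <> 0 -> 0 < nrm a.
Proof. by move=> a0; rewrite lt_def nrm_ge0 andbT; apply/eqP=> /nrm_eq0. Qed.

Lemma nrm_sum (I : Type) (s : seq I) (F : I -> A) :
  nrm (\sum_(i <- s) F i) <= \sum_(i <- s) nrm (F i).
Proof.
elim/big_rec2: _ => [|i p q _ IH]; first by rewrite nrm0.
by have := nrmD (F i) q; lra.
Qed.

Lemma nrm_st a : nrm (st a) = nrm a.
Proof.
have le b : nrm b <= nrm (st b).
  have := nrm_st_mul b; have := nrmM (st b) b; have := nrm_ge0 b.
  have := nrm_ge0 (st b) => *; case: (lerP (nrm b) (nrm (st b))) => //; nra.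
by apply/eqP; rewrite eq_le -{2}(stK a) !le.
Qed.

Lemma st0 : st 0 = 0.
Proof. by apply: (addrI (st 0)); rewrite -stD !addr0. Qed.

Lemma stN a : st (- a) = - st a.
Proof. by apply/eqP; rewrite -addr_eq0 -stD addNr st0. Qed.

Lemma stB a b : st (a - b) = st a - st b.
Proof. by rewrite stD stN. Qed.

Lemma st1 : st 1 = 1.
Proof. by have := stM (st 1) 1; rewrite mulr1 !stK mulr1. Qed.

Lemma stX a n : st (a ^+ n) = st a ^+ n.
Proof.
by elim: n => [|n IH]; rewrite ?expr0 ?st1 // exprS stM IH -exprSr.
Qed.

Lemma st_sum (I : finType) (F : I -> A) : st (\sum_i F i) = \sum_i st (F i).
Proof. exact: (big_morph st stD st0). Qed.

Lemma nrm_sqr a : st a = a -> nrm (a * a) = nrm a ^+ 2.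
Proof. by move=> sa; rewrite -nrm_st_mul sa. Qed.

(** Iterated C*-identity; each application doubles the exponent, so the exponents chosen below are
    powers of two. *)
Lemma nrm_pow2X a k : st a = a -> nrm (a ^+ (2 ^ k)) = nrm a ^+ (2 ^ k).
Proof.
move=> sa; elim: k => [|k IH]; first by rewrite !expr1.
by rewrite expnSr !exprM expr2 nrm_sqr ?IH // stX sa.
Qed.

Lemma nrm1 : nrm 1 = 1.
Proof.
have /nrm_gt0 n0 : (1 : A) <> 0 by apply/eqP/oner_neq0.
by have := nrm_sqr st1; rewrite mulr1; nra.
Qed.

Lemma nrmX a n : nrm (a ^+ n) <= nrm a ^+ n.
Proof.
elim: n => [|n IH]; first by rewrite !expr0 nrm1.
rewrite !exprS; apply: le_trans (nrmM _ _) _; by apply: ler_wpM2l IH; apply: nrm_ge0.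
Qed.

Lemma nrmM_le a b r d : nrm a <= r -> nrm b <= d -> nrm (a * b) <= r * d.
Proof.
move=> ar bd; apply: le_trans (nrmM _ _) _.
by apply: ler_pM ar bd; apply: nrm_ge0.
Qed.

Lemma small_nrm_eq0 a : (forall e, 0 < e -> nrm a <= e) -> a = 0.
Proof.
move=> small; apply: nrm_eq0; apply/eqP; rewrite eq_le nrm_ge0 andbT.
by apply/ler_addgt0Pr => e /small; rewrite add0r.
Qed.

(** Transfers closed conditions to limits: with [phi] a commutator or [st a - a], commutation and
    self-adjointness pass from the iterates to their limit. *)
Lemma limit_ker u l (phi : A -> A) K : converges_to nrm u l ->
  (forall a b, phi (a - b) = phi a - phi b) -> (forall a, nrm (phi a) <= K * nrm a) ->
  (forall n, phi (u n) = 0) -> phi l = 0.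
Proof.
move=> ul phiB phiK phiu; apply: small_nrm_eq0 => e e0.
have K0 : 0 < `|K| + 1 by have := normr_ge0 K; lra.
have [N /(_ N (leqnn N)) lt_e] := ul _ (divr_gt0 e0 K0).
have -> : phi l = phi (l - u N) by rewrite phiB phiu subr0.
apply: le_trans (phiK _) _; rewrite nrm_distC.
move: lt_e; rewrite ltr_pdivlMr // => lt_e.
have := nrm_ge0 (u N - l); have := ler_norm K; nra.
Qed.

Lemma limit_nrm_le u l r : converges_to nrm u l -> (forall n, nrm (u n) <= r) ->
  nrm l <= r.
Proof.
move=> ul ur; apply/ler_addgt0Pr => e /ul [N /(_ N (leqnn N))].
rewrite nrm_distC => lt_e; have := nrmD (u N) (l - u N); have := ur N.
by rewrite addrC subrK; lra.
Qed.


(** * Square roots and spectral cut-offs *)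

Fixpoint sqrt_iter z n : A :=
  if n is m.+1 then (2^-1)%:C *: (z + sqrt_iter z m * sqrt_iter z m) else 0.

Fixpoint sqrt_majorant n : R :=
  if n is m.+1 then (1 + sqrt_majorant m ^+ 2) / 2 else 0.

Lemma sqrt_majorant_le1 n : 0 <= sqrt_majorant n <= 1.
Proof. by elim: n => [|n /andP[]] /=; rewrite ?lexx ?ler01 //; nra. Qed.

(** An explicit rate for the convergence of the majorant to 1, from which the Cauchy modulus of the
    iteration is read off. *)
Lemma sqrt_majorant_ge n : 1 - 2 / (n.+2)%:R <= sqrt_majorant n.
Proof.
elim: n => [|n IH]; first by rewrite divff ?subrr ?pnatr_eq0.
rewrite -[n.+3%:R]natr1 /=.
have p2 : 2 <= n.+2%:R :> R by rewrite ler_nat.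
have /andP[t0 t1] := sqrt_majorant_le1 n.
move: IH p2 t0 t1; move: (sqrt_majorant n) (n.+2%:R : R) => t p IH p2 t0 t1.
have i1 : p * p^-1 = 1 by rewrite divff //; lra.
have j1 : (p + 1) * (p + 1)^-1 = 1 by rewrite divff //; lra.
move: IH i1 j1; move: p^-1 (p + 1)^-1 => i j IH i1 j1.
have i0 : 0 < i by nra.
have j0 : 0 < j by nra.
(* Here [i] and [j] are the inverses of consecutive integers. The inductive step amounts to
   [1 - 2 * j <= 1 - 2 * i + 2 * i * i], that is, to [i - j <= i * i]. *)
have ij : i - j = i * j.
  have : i * ((p + 1) * j) - j * (p * i) - i * j = 0 by ring.
  by rewrite i1 j1 !mulr1; lra.
have ji : i * j <= i * i by nra.
have : (1 - 2 * i) ^+ 2 <= t ^+ 2 by apply: lerXn2r; rewrite ?nnegrE; nra.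
lra.
Qed.

Lemma sqrt_iter_nrm z m : nrm z <= 1 -> nrm (sqrt_iter z m) <= sqrt_majorant m.
Proof.
move=> z1; elim: m => [|m IH] /=; first by rewrite nrm0.
rewrite nrmZ ger0_norm ?invr_ge0 ?ler0n // mulrC ler_pM2r ?invr_gt0 ?ltr0n //.
by rewrite expr2; apply: le_trans (nrmD _ _) _; apply: lerD (nrmM_le IH IH).
Qed.

Lemma sqrt_iter_comm z c m : z * c = c * z -> sqrt_iter z m * c = c * sqrt_iter z m.
Proof.
move=> zc; elim: m => [|m IH] /=; first by rewrite mul0r mulr0.
by rewrite -scalerAl -scalerAr mulrDl mulrDr zc -mulrA IH !mulrA IH.
Qed.

Lemma sqrt_iter_st z m : st z = z -> st (sqrt_iter z m) = sqrt_iter z m.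
Proof.
by move=> sz; elim: m => [|m IH] /=; rewrite ?st0 // stZr stD stM sz IH.
Qed.

Lemma sqrt_iter_dist z m n : nrm z <= 1 ->
  nrm (sqrt_iter z (m + n) - sqrt_iter z m) <= sqrt_majorant (m + n) - sqrt_majorant m.
Proof.
move=> z1; elim: m => [|m IH] /=; first by rewrite !subr0 sqrt_iter_nrm.
set u := sqrt_iter z (m + n); set v := sqrt_iter z m.
set a := sqrt_majorant (m + n) in IH *; set b := sqrt_majorant m in IH *.
have uv : u * v = v * u by apply/sqrt_iter_comm/esym/sqrt_iter_comm.
have -> : (2^-1)%:C *: (z + u * u) - (2^-1)%:C *: (z + v * v) =
    (2^-1)%:C *: ((u - v) * (u + v)).
  rewrite -scalerBr opprD addrACA subrr add0r; congr (_ *: _).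
  by rewrite mulrBl !mulrDr uv opprD addrACA addrA subrK.
rewrite nrmZ ger0_norm ?invr_ge0 ?ler0n //.
have ab : nrm (u + v) <= a + b.
  by apply: le_trans (nrmD _ _) _; apply: lerD; apply: sqrt_iter_nrm.
have := nrmM_le IH ab; lra.
Qed.

(* [1 - x] is the square root of [1 - z]; the map [u -> (z + u^2) / 2] has fixed
   point [x], and its iterates are dominated by those of [t -> (1 + t^2) / 2]. *)
Lemma sqrt_exists z : nrm z <= 1 -> exists x,
  [/\ (1 - x) * (1 - x) = 1 - z, nrm x <= 1,
      (forall c, z * c = c * z -> x * c = c * x) & (st z = z -> st x = x)].
Proof.
move=> z1.
have [x ux] : exists x, converges_to nrm (sqrt_iter z) x.
  apply: cauchy_converges => e e0.
  have near m n : 2 / m.+2%:R < e -> (m <= n)%N ->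
      nrm (sqrt_iter z n - sqrt_iter z m) < e.
    move=> me /subnKC <-; have := sqrt_iter_dist m (n - m) z1.
    have /andP[_] := sqrt_majorant_le1 (m + (n - m)); have := sqrt_majorant_ge m.
    by move: me; move: (2 / _) => q; lra.
  have small m : (Num.truncn (2 / e) <= m)%N -> 2 / m.+2%:R < e.
    move=> Nm; rewrite ltr_pdivrMr ?ltr0n // mulrC -ltr_pdivrMr //.
    apply: lt_trans (truncnS_gt _) _; rewrite ltr_nat.
    exact: leq_ltn_trans (Nm : (_ < m.+1)%N) (ltnSn _).
  exists (Num.truncn (2 / e)) => m n Nm Nn; case: (leqP m n) => [|/ltnW] mn.
    by rewrite nrm_distC; apply: near mn; apply: small.
  by apply: near mn; apply: small.
have x1 : nrm x <= 1.
  apply: limit_nrm_le ux _ => n.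
  by have := sqrt_iter_nrm n z1; have /andP[_] := sqrt_majorant_le1 n; lra.
exists x; split.
- have E : x + x - (z + x * x) = 0.
    apply: small_nrm_eq0 => e e0.
    (* The defect of the fixed-point equation is split into four terms: [x - v] twice, [u * (u - x)]
       and [(u - x) * x], each of norm at most [e / 4]. *)
    have e4 : 0 < e / 4 by lra.
    have [N uN] := ux _ e4.
    have {uN}[u0 u1] := (uN N (leqnn N), uN N.+1 (leqnSn N)).
    set v := sqrt_iter z N.+1 in u1; set u := sqrt_iter z N in u0.
    have half : 2^-1 + 2^-1 = 1 :> R by lra.
    have vE : v + v = z + u * u by rewrite /v /= -/u -scalerDl -rmorphD half scale1r.
    have -> : x + x - (z + x * x) = (x - v) + (x - v) + (u * (u - x) + (u - x) * x).
      have -> : u * (u - x) + (u - x) * x = u * u - x * x.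
        by rewrite mulrBr mulrBl addrA subrK.
      by rewrite [x - v + (x - v)]addrACA -opprD vE !opprD !addrA subrK.
    have u1' : nrm u <= 1.
      by have := sqrt_iter_nrm N z1; have /andP[_] := sqrt_majorant_le1 N; rewrite -/u; lra.
    rewrite nrm_distC in u1.
    have := nrmM_le u1' (lexx (nrm (u - x))); have := nrmM_le (lexx (nrm (u - x))) x1.
    have := nrmD (x - v) (x - v); have := nrmD (u * (u - x)) ((u - x) * x).
    have := nrmD (x - v + (x - v)) (u * (u - x) + (u - x) * x); lra.
  move/eqP: E; rewrite subr_eq0 => /eqP E.
  rewrite mulrBl mul1r mulrBr mulr1 opprB addrACA -opprD E opprD addrACA.
  by rewrite subrr addr0.
- exact: x1.
- move=> c zc; apply/eqP; rewrite -subr_eq0; apply/eqP.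
  apply: (limit_ker (phi := fun a => a * c - c * a) (K := 2 * nrm c) ux) => [a b|a|n].
  + by rewrite mulrBl mulrBr !opprD !opprK addrACA.
  + by have := nrmB (a * c) (c * a); have := nrmM a c; have := nrmM c a; lra.
  + by rewrite sqrt_iter_comm // subrr.
- move=> sz; apply/eqP; rewrite -subr_eq0; apply/eqP.
  apply: (limit_ker (phi := fun a => st a - a) (K := 2) ux) => [a b|a|n].
  + by rewrite stB !opprD !opprK addrACA.
  + by have := nrmB (st a) a; rewrite nrm_st; lra.
  + by rewrite sqrt_iter_st // subrr.
Qed.

(* [y + i s] is [sqrt r] times a unitary, and [y] is its real part. *)
Lemma nrm_le_of_sqr_sum y q r : st y = y -> st q = q -> y * q = q * y ->
  y * y + q * q = r%:C *: 1 -> nrm y ^+ 2 <= `|r|.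
Proof.
move=> sy sq yq yqr; set iq := 'i%C *: q.
have siq : st iq = - iq.
  rewrite /iq stZ sq -scaleNr; congr (_ *: _).
  by apply/eqP; rewrite eq_complex /= oppr0 !eqxx.
have uu : st (y + iq) * (y + iq) = r%:C *: 1.
  rewrite stD sy siq mulrDl !mulrDr !mulNr /iq -!scalerAl -!scalerAr -yq -yqr.
  rewrite addrA addrK scalerA -scaleNr; congr (_ + _); rewrite -[RHS]scale1r.
  congr (_ *: _); apply/eqP; rewrite eq_complex /= !mul0r !mulr1 !mul1r !add0r.
  by rewrite ?subr0 ?addr0 oppr0 ?sub0r ?opprK !eqxx.
have := nrm_st_mul (y + iq); rewrite uu nrmZ nrm1 mulr1 => ->.
have yy : y + y = (y + iq) + st (y + iq) by rewrite stD sy siq addrACA subrr addr0.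
have n2 : nrm (y + y) = 2 * nrm y.
  have -> : y + y = 2%:C *: y by rewrite rmorphD !rmorph1 scalerDl scale1r.
  by rewrite nrmZ ger0_norm.
have := nrmD (y + iq) (st (y + iq)); rewrite -yy n2 nrm_st => le_n.
apply: lerXn2r; rewrite ?nnegrE ?nrm_ge0 //; lra.
Qed.

(** Write [1 - y * y] as the square of the self-adjoint [1 - x]. Then the squares of [1 - x] and [y]
    sum to 1, which bounds [1 - x] without functional calculus. *)
Lemma nrm_one_sub_sqr y : st y = y -> nrm y <= 1 -> nrm (1 - y * y) <= 1.
Proof.
move=> sy y1; have [|x [xE _ xC xS]] := @sqrt_exists (y * y).
  by have := nrmM_le y1 y1; rewrite mulr1.
have {xS} sx : st (1 - x) = 1 - x by rewrite stB st1 xS // stM sy.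
have yx : y * (1 - x) = (1 - x) * y.
  by rewrite mulrBr mulrBl xC ?mulr1 ?mul1r // mulrA.
rewrite -xE nrm_sqr //.
have := @nrm_le_of_sqr_sum (1 - x) y 1 sx sy (esym yx).
rewrite xE subrK rmorph1 scale1r normr1; exact.
Qed.

(* [h] is twice the positive part of [z = w - (1 - d)], where [w = (a^* a)^2];
   with [|z| = 1 - x], [w] agrees on the range of [h] with [(2 - d) - x], which is
   bounded below by [1 - d] because [|x| <= 1]. *)
Lemma spectral_bump y d : st y = y -> nrm y = 1 -> 0 < d < 1 ->
  exists2 h, h <> 0 & forall n q,
    (1 - d) ^+ n * nrm (h * q) <= nrm ((y * y) ^+ n * h * q).
Proof.
move=> sy y1 /andP[d0 d1]; set w := y * y.
have w1 : nrm w = 1 by rewrite /w nrm_sqr // y1 expr1n.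
set k := (1 - d)%:C *: (1 : A); set z := w - k.
have kC c : k * c = c * k by rewrite /k -scalerAl -scalerAr mul1r mulr1.
have sk : st k = k by rewrite /k stZr st1.
have sz : st z = z by rewrite /z stB sk /w stM sy.
have z1 : nrm z <= 1.
  (* The coefficients [d] and [1 - d] sum to 1, and both [w] and [1 - w] have norm at most 1. *)
  have -> : z = d%:C *: w - (1 - d)%:C *: (1 - w).
    rewrite scalerBr opprB addrA -scalerDl -rmorphD.
    by rewrite (_ : d + (1 - d) = 1) ?rmorph1 ?scale1r //; lra.
    have := nrm_one_sub_sqr sy; rewrite -/w y1 lexx => /(_ isT) w1'.
  have := nrmB (d%:C *: w) ((1 - d)%:C *: (1 - w)).
  by rewrite !nrmZ w1 !ger0_norm; nra.
(* The square root is taken of [1 - (1 - z * z)], so that [1 - x] plays the role of the absolute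
   value of [z]. *)
have [x [xE x1 xC xS]] := sqrt_exists (nrm_one_sub_sqr sz z1).
have {xE} xE : (1 - x) * (1 - x) = z * z by rewrite xE subKr.
have {xS} sx : st x = x by apply: xS; rewrite stB st1 stM sz.
have {}xC c : z * c = c * z -> x * c = c * x.
  by move=> zc; apply: xC; rewrite mulrBl (mulrBr c) mul1r mulr1 -mulrA zc mulrA zc mulrA.
have zy : z * y = y * z.
  by rewrite /z mulrBl (mulrBr y) kC /w mulrA.
exists (z + (1 - x)).
  (* If the sum vanished, [(1 - d) - w] would be [1 - x], itself a square of some [1 - x']. Then
     [y * y] and this square would sum to [1 - d], forcing [nrm y ^+ 2 <= 1 - d]. *)
  move=> /eqP; rewrite addr_eq0 => /eqP zx.
  have [x' [x'E _ x'C x'S]] := sqrt_exists x1.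
  have sx' : st (1 - x') = 1 - x' by rewrite stB st1 x'S.
  have yx' : y * (1 - x') = (1 - x') * y.
    by rewrite mulrBr mulrBl mulr1 mul1r x'C // xC.
  have := @nrm_le_of_sqr_sum y (1 - x') (1 - d) sy sx' yx'.
  rewrite y1 x'E -/w -/k expr1n ger0_norm ?subr_ge0 ?(ltW d1) // => le_d.
  have : 1 <= 1 - d by apply: le_d; rewrite -[w](subrK k) -/z zx addrAC addNr add0r.
  lra.
set h := z + (1 - x).
have xz : x * z = z * x by apply: xC.
(* Since [z] commutes with [1 - x] and both have the same square, [z * h = (1 - x) * h]. *)
have hE : w * h = (k + (1 - x)) * h.
  rewrite -[w](subrK k) -/z addrC (mulrDl k z) (mulrDl k (1 - x)); congr (_ + _).
  rewrite /h (mulrDr z) (mulrDr (1 - x)) xE addrC; congr (_ + _).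
  by rewrite (mulrBr z) [(1 - x) * z]mulrBl mulr1 mul1r xz.
have hw : h * w = w * h.
  have zw : z * w = w * z by rewrite /w mulrA zy -mulrA zy mulrA.
  rewrite /h mulrDl (mulrDr w) zw [(1 - x) * w]mulrBl [w * (1 - x)]mulrBr.
  by rewrite mul1r mulr1 (xC _ zw).
elim=> [|n IH] q; first by rewrite !expr0 !mul1r.
have hwn : h * w ^+ n = w ^+ n * h by apply: commrX.
have -> : w ^+ n.+1 * h * q = (k + (1 - x)) * (w ^+ n * h * q).
  by rewrite exprS -(mulrA w) -hwn mulrA hE -(mulrA _ h) hwn !mulrA.
set p := w ^+ n * h * q in IH *.
(* As [k + (1 - x)] is [2 - d] minus [x] and [nrm x <= 1], multiplying [p] by it leaves norm at
   least [(1 - d) * nrm p]. *)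
have : nrm (k * p + p) <= nrm ((k + (1 - x)) * p) + nrm (x * p).
  apply: le_trans (nrmD _ _).
  by rewrite -mulrDl addrA subrK mulrDl mul1r.
have := nrmM_le x1 (lexx (nrm p)).
have -> : k * p + p = (2 - d)%:C *: p.
  rewrite /k -scalerAl mul1r -[X in _ + X]scale1r -scalerDl -(rmorph1 (real_complex R)).
  by rewrite -rmorphD addrAC.
rewrite nrmZ ger0_norm; last lra.
have := IH q; rewrite -/p exprS; nra.
Qed.

(** The closure of the algebraic ideal generated by [h] is a closed ideal containing [h]; simplicity
    makes it everything, so it contains 1. *)
Lemma simple_full h : simple_cstar nrm -> h <> 0 ->
  exists s : seq (A * A), nrm (1 - \sum_(p <- s) p.1 * h * p.2) < 2^-1.
Proof.
move=> simple h0.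
pose I b := forall e, 0 < e ->
  exists s : seq (A * A), nrm (b - \sum_(p <- s) p.1 * h * p.2) < e.
have I_M a b : I b -> I (a * b) /\ I (b * a).
  move=> Ib.
  have a1 : 0 < nrm a + 1 by have := nrm_ge0 a; lra.
  have lt_e e v : nrm v < e / (nrm a + 1) -> nrm a * nrm v < e.
    rewrite ltr_pdivlMr //; have := nrm_ge0 v; nra.
  split=> e e0; have [s sP] := Ib _ (divr_gt0 e0 a1).
    exists [seq (a * p.1, p.2) | p <- s]; rewrite big_map /=.
    under eq_bigr do rewrite -!mulrA; under eq_bigr do rewrite !mulrA.
    rewrite (_ : _ - _ = a * (b - \sum_(p <- s) p.1 * h * p.2)).
      exact: le_lt_trans (nrmM _ _) (lt_e _ _ sP).
    by rewrite mulrBr big_distrr /=; under [in RHS]eq_bigr do rewrite !mulrA.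
  exists [seq (p.1, p.2 * a) | p <- s]; rewrite big_map /=.
  rewrite (_ : _ - _ = (b - \sum_(p <- s) p.1 * h * p.2) * a).
    by apply: le_lt_trans (nrmM _ _) _; rewrite mulrC; apply: lt_e.
  by rewrite mulrBl big_distrl /=; under eq_bigr do rewrite mulrA.
have : closed_ideal nrm I.
  split=> //.
  - by move=> e e0; exists [::]; rewrite big_nil subrr nrm0.
  - move=> a b Ia Ib e e0.
    have e2 : 0 < e / 2 by lra.
    have [s sP] := Ia _ e2; have [t tP] := Ib _ e2; exists (s ++ t).
    by rewrite big_cat opprD addrACA; apply: le_lt_trans (nrmD _ _) _; lra.
  - by move=> k a /(I_M (k *: 1)) []; rewrite -scalerAl mul1r.
  - move=> u l Iu ul e e0.
    have e2 : 0 < e / 2 by lra.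
    have [N /(_ N (leqnn N)) uN] := ul _ e2.
    have [s sP] := Iu N _ e2; exists s; rewrite nrm_distC in uN.
    rewrite -[l](subrK (u N)) -addrA; apply: le_lt_trans (nrmD _ _) _; lra.
case/simple=> [I0|]; last by move=> /(_ 1 2^-1); apply; lra.
case: h0; apply: I0 => e e0; exists [:: (1, 1)].
by rewrite big_seq1 mul1r mulr1 subrr nrm0.
Qed.

(** * Expressions in an almost central contraction *)

(** These are the features of a tower sum on which the compression estimate rests; one parameter
    controls both the norm defect and the commutators. *)
Definition near_central (F : seq A) e f : Prop :=
  [/\ st f = f, nrm f <= 1, 1 - e < nrm f &
      forall c, c \in F -> nrm (f * c - c * f) <= e].

(** A filter of properties, standing in for statements about central sequences whose norms tend to
    1. *)
Definition eventually_central (P : A -> Prop) : Prop :=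
  exists (F : seq A) e, 0 < e /\ forall f, near_central F e f -> P f.

Lemma near_central_weaken (F F' : seq A) e e' f :
  {subset F <= F'} -> e' <= e -> near_central F' e' f -> near_central F e f.
Proof.
move=> FF ee [sf f1 fe fF]; split=> // [|c /FF /fF]; lra.
Qed.

Lemma eventually_central_and P Q : eventually_central P -> eventually_central Q ->
  eventually_central (fun f => P f /\ Q f).
Proof.
move=> [F [e [e0 FP]]] [F' [e' [e'0 FQ]]]; exists (F ++ F'), (Num.min e e').
split=> [|f fP]; first by rewrite lt_min e0.
split; [apply: FP|apply: FQ]; apply: near_central_weaken fP.
- by move=> c; rewrite mem_cat => ->.
- by rewrite ge_min lexx.
- by move=> c; rewrite mem_cat orbC => ->.
- by rewrite ge_min lexx orbT.
Qed.

Lemma eventually_central_imp (P Q : A -> Prop) :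
  (forall f, st f = f -> nrm f <= 1 -> P f -> Q f) ->
  eventually_central P -> eventually_central Q.
Proof.
move=> PQ [F [e [e0 FP]]]; exists F, e; split=> // f Ff.
by case: (Ff) => *; apply: PQ => //; apply: FP.
Qed.

Lemma eventually_central_all (P : A -> A -> Prop) (F : seq A) :
  (forall a, eventually_central (P a)) ->
  eventually_central (fun f => forall a, a \in F -> P a f).
Proof.
move=> evP; elim: F => [|a F IH]; first by exists [::], 1; split.
apply: eventually_central_imp (eventually_central_and (evP a) IH) => f _ _ [Pa PF] b.
by rewrite inE => /predU1P[->|/PF].
Qed.

(* [P f] is, up to an error that vanishes as [f] becomes central, the monomial
   [c f^j]. *)
Definition asymp (P : A -> A) c j : Prop :=
  (exists K, forall f, nrm f <= 1 -> nrm (P f) <= K) /\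
  forall e, 0 < e -> eventually_central (fun f => nrm (P f - c * f ^+ j) <= e).

Lemma asymp_cst c : asymp (fun=> c) c 0.
Proof.
split=> [|e e0]; first by exists (nrm c).
by exists [::], 1; split=> // f _; rewrite mulr1 subrr nrm0 ltW.
Qed.

Lemma asymp_id : asymp id 1 1.
Proof.
split=> [|e e0]; first by exists 1.
by exists [::], 1; split=> // f _; rewrite mul1r subrr nrm0 ltW.
Qed.

Lemma asymp_add P Q c (d : A) j : asymp P c j -> asymp Q d j ->
  asymp (fun f => P f + Q f) (c + d) j.
Proof.
move=> [[K PK] Pc] [[L QL] Qd]; split=> [|e e0].
  exists (K + L) => f f1; apply: le_trans (nrmD _ _) _.
  exact: lerD (PK _ f1) (QL _ f1).
have e2 : 0 < e / 2 by lra.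
apply: eventually_central_imp (eventually_central_and (Pc _ e2) (Qd _ e2)).
move=> f _ _ [Pf Qf]; rewrite mulrDl opprD addrACA.
by apply: le_trans (nrmD _ _) _; lra.
Qed.

Lemma asymp_sum (I : Type) (s : seq I) (P : I -> A -> A) (c : I -> A) j :
  (forall i, asymp (P i) (c i) j) ->
  asymp (fun f => \sum_(i <- s) P i f) (\sum_(i <- s) c i) j.
Proof.
move=> Pc; elim: s => [|i s [[K IHK] IHc]].
  split=> [|e e0]; first by exists 0 => f _; rewrite big_nil nrm0.
  by exists [::], 1; split=> // f _; rewrite !big_nil mul0r subrr nrm0 ltW.
have [[L HL] Hc] := asymp_add (Pc i) (conj (ex_intro _ K IHK) IHc).
split=> [|e e0]; first by exists L => f f1; rewrite big_cons HL.
by apply: eventually_central_imp (Hc e e0) => f _ _; rewrite !big_cons.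
Qed.

Lemma eventually_comm_pow c j e : 0 < e ->
  eventually_central (fun f => nrm (f ^+ j * c - c * f ^+ j) <= e).
Proof.
elim: j e => [|j IH] e e0.
  by exists [::], 1; split=> // f _; rewrite mulr1 mul1r subrr nrm0 ltW.
have e2 : 0 < e / 2 by lra.
have ev1 : eventually_central (fun f => nrm (f * c - c * f) <= e / 2).
  by exists [:: c], (e / 2); split=> // f [_ _ _]; apply; rewrite inE.
apply: eventually_central_imp (eventually_central_and (IH _ e2) ev1) => f _ f1 [fj fc].
have -> : f ^+ j.+1 * c - c * f ^+ j.+1 =
    f ^+ j * (f * c - c * f) + (f ^+ j * c - c * f ^+ j) * f.
  by rewrite mulrBr mulrBl !mulrA addrA subrK -exprSr -mulrA -exprSr.
apply: le_trans (nrmD _ _) _.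
have fj1 : nrm (f ^+ j) <= 1.
  by apply: le_trans (nrmX _ _) _; apply: exprn_ile1; rewrite ?nrm_ge0.
have := nrmM_le fj1 fc; have := nrmM_le fj f1; lra.
Qed.

(** Three errors arise: replacing [P f], replacing [Q f], and moving [f ^+ j] past [d]. The uniform
    bound built into [asymp] controls the first of them. *)
Lemma asymp_mul P Q c (d : A) j k : asymp P c j -> asymp Q d k ->
  asymp (fun f => P f * Q f) (c * d) (j + k).
Proof.
move=> [[K PK] Pc] [[L QL] Qd]; split=> [|e e0].
  by exists (K * L) => f f1; apply: nrmM_le; [apply: PK|apply: QL].
have L0 : 0 <= L by apply: le_trans (nrm_ge0 _) (QL 0 _); rewrite nrm0.
have c0 := nrm_ge0 c.
have e1 : 0 < e / 3 / (L + 1) by rewrite divr_gt0; lra.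
have e2 : 0 < e / 3 / (nrm c + 1) by rewrite divr_gt0; lra.
apply: eventually_central_imp (eventually_central_and (Pc _ e1)
  (eventually_central_and (Qd _ e2) (eventually_comm_pow d j e2))).
move=> f sf f1 [Pf [Qf fd]].
have -> : P f * Q f - c * d * f ^+ (j + k) = (P f - c * f ^+ j) * Q f +
    c * f ^+ j * (Q f - d * f ^+ k) + c * ((f ^+ j * d - d * f ^+ j) * f ^+ k).
  rewrite mulrBl (mulrBr (c * f ^+ j)) addrA subrK mulrBl mulrBr !mulrA.
  by rewrite addrA subrK -!mulrA -exprD.
have fX n : nrm (f ^+ n) <= 1.
  by apply: le_trans (nrmX _ _) _; apply: exprn_ile1; rewrite ?nrm_ge0.
have ce : (nrm c + 1) * (e / 3 / (nrm c + 1)) = e / 3 by rewrite mulrC divfK //; lra.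
have Le : (L + 1) * (e / 3 / (L + 1)) = e / 3 by rewrite mulrC divfK //; lra.
have := nrmM_le Pf (QL _ f1).
have := nrmM_le (nrmM_le (lexx (nrm c)) (fX j)) Qf.
have := nrmM_le (lexx (nrm c)) (nrmM_le fd (fX k)).
move: e1 e2 ce Le; move: (e / 3 / (L + 1)) (e / 3 / (nrm c + 1)) => p q *.
apply: le_trans (nrmD _ _) _; apply: le_trans (lerD (nrmD _ _) (lexx _)) _; nra.
Qed.

Lemma asymp_exp P c j n : asymp P c j -> asymp (fun f => P f ^+ n) (c ^+ n) (j * n).
Proof.
move=> Pc; elim: n => [|n IH]; first by rewrite muln0; apply: asymp_cst.
rewrite exprS mulnS; have [[K HK] Hc] := asymp_mul Pc IH.
split=> [|e e0]; first by exists K => f; rewrite exprS; apply: HK.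
by apply: eventually_central_imp (Hc e e0) => f _ _; rewrite exprS.
Qed.

(** * Lower bound for compressions by almost central contractions *)

Lemma bernoulli (x : R) n : -1 <= x -> 1 + n%:R * x <= (1 + x) ^+ n.
Proof.
move=> x1; elim: n => [|n IH]; first by rewrite mul0r addr0 expr0.
rewrite exprS -natr1; have := ler0n R n; move: IH; move: (n%:R : R) => m; nra.
Qed.

Lemma exists_pow2_gt (x C : R) : 1 < x -> exists J, C < x ^+ (2 ^ J).
Proof.
move=> x1; have x0 : 0 < x - 1 by lra.
pose J := (Num.truncn (C / (x - 1))).+1; exists J.
have /(@bernoulli _ (2 ^ J)) : -1 <= x - 1 by lra.
rewrite [1 + (x - 1)]addrC subrK => le_x; apply: lt_le_trans le_x.
have : C / (x - 1) < (2 ^ J)%:R.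
  by apply: lt_trans (truncnS_gt _) _; rewrite ltr_nat ltn_expl.
by rewrite ltr_pdivrMr // => ?; lra.
Qed.

Lemma central_compression_unit a e : simple_cstar nrm -> nrm a = 1 -> 0 < e < 1 ->
  eventually_central (fun f => 1 - e < nrm (f * a * f)).
Proof.
move=> simple a1 /andP[e0 e1]; pose y := st a * a; pose d := e / 2.
have [||| h h0 hP] := @spectral_bump y d.
- by rewrite /y stM stK.
- by rewrite /y nrm_st_mul a1 expr1n.
- by rewrite /d; lra.
have [s sP] := simple_full simple h0.
set r := \sum_(p <- s) _ in sP.
pose M := 1 + \sum_(p <- s) nrm p.1 * nrm p.2.
have M1 : 1 <= M by rewrite lerDl sumr_ge0 // => p _; rewrite mulr_ge0 ?nrm_ge0.
(* The gap between [1 - e] and [1 - d] beats any constant. The factor 16 is twice the 8 in the bound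
   [1 <= 8 * M * nrm (h * v)] below, which leaves room for the error [eta]. *)
have [J JP] : exists J, 16 * M * nrm h * (1 - e) ^+ (2 ^ J) < (1 - d) ^+ (2 ^ J).
  have [|J JP] := @exists_pow2_gt ((1 - d) / (1 - e)) (16 * M * nrm h).
    by rewrite ltr_pdivlMr /d; lra.
  by exists J; rewrite -ltr_pdivlMr -?exprVn -?exprMn ?exprn_gt0 //; lra.
(* [T f] contains four factors [f] and is raised to the power [2 * n]; hence [k], again a power of
   two. *)
set n := (2 ^ J)%N in JP *; pose k := (4 * (2 * n))%N.
pose T f := f * st a * f * (f * a * f).
have d_n : 0 < (1 - d) ^+ n by rewrite exprn_gt0 // /d; lra.
have asT : asymp (fun f => T f ^+ (2 * n) * h) (y ^+ (2 * n) * h) (k + 0).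
  apply: asymp_mul (asymp_cst h); apply: (@asymp_exp T y 4).
  have as1 b := asymp_mul (asymp_mul asymp_id (asymp_cst b)) asymp_id.
  by have := asymp_mul (as1 (st a)) (as1 a); rewrite !mul1r !mulr1.
have asD : asymp (fun f => \sum_(p <- s) p.1 * (h * f ^+ k) * p.2) r k.
  apply: asymp_sum => p.
  have := asymp_mul (asymp_mul (asymp_cst p.1)
    (asymp_mul (asymp_cst h) (asymp_exp k asymp_id))) (asymp_cst p.2).
  by rewrite expr1n mulr1 mul1n !add0n addn0.
have evf : eventually_central (fun f => 2^-1 <= nrm (f ^+ k)).
  have k0 : 0 < k%:R :> R by rewrite ltr0n !muln_gt0 expn_gt0.
  (* No commutators are needed here: a norm above [1 - 1/(2k)] suffices, since its [k]-th power is
     at least 1/2 by Bernoulli. *)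
  exists [::], (2 * k%:R)^-1; split; first by rewrite invr_gt0; lra.
  move=> f [sf f1 fe _].
  have kE : k = (2 ^ J.+3)%N by rewrite /k !expnS !mulnA.
  rewrite {1}kE nrm_pow2X // -kE.
  have kk : k%:R * (2 * k%:R)^-1 = 2^-1 :> R.
    by rewrite invfM mulrCA divff ?mulr1 // gt_eqF.
  have k1 : 1 <= k%:R :> R by rewrite ler1n -(ltr0n R).
  have i1 : (2 * k%:R)^-1 <= 1 :> R by rewrite invf_le1; lra.
  have := @bernoulli (- (2 * k%:R)^-1) k.
  rewrite mulrN kk lerN2 => /(_ i1) le1.
  apply: (le_trans (y := (1 - (2 * k%:R)^-1) ^+ k)).
    by apply: le_trans le1; lra.
  by apply: lerXn2r; rewrite ?nnegrE ?nrm_ge0 ?subr_ge0 // ltW.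
have eta0 : 0 < (1 - d) ^+ n / (16 * M) by rewrite divr_gt0; lra.
have e8 : 0 < 8^-1 :> R by lra.
apply: eventually_central_imp (eventually_central_and (asT.2 _ eta0)
  (eventually_central_and (asD.2 _ e8) evf)) => f sf f1 [].
rewrite addn0 => fT [fD fk]; rewrite ltNge; apply/negP => fle.
have sT : nrm (T f) = nrm (f * a * f) ^+ 2.
  by rewrite -nrm_st_mul !stM sf (mulrA f (st a)).
have T_n : nrm (T f ^+ (2 * n)) <= (1 - e) ^+ n.
  apply: le_trans (nrmX _ _) _; rewrite sT -exprM mulnA exprM.
  apply: lerXn2r; rewrite ?nnegrE ?exprn_ge0 ?nrm_ge0 //; first lra.
  have t0 := nrm_ge0 (f * a * f); rewrite exprM.
  have t2 : nrm (f * a * f) ^+ 2 <= 1 - e by rewrite expr2; nra.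
  by move: t2 (sqr_ge0 (nrm (f * a * f))); move: (_ ^+ 2) => t *; rewrite expr2; nra.
set v := f ^+ k in fT fD fk.
(* [r] is within 1/2 of 1 and [nrm v] is at least 1/2; the later approximation error 1/8 then still
   leaves 1/8. *)
have lower : 4^-1 <= nrm (r * v).
  have := nrmM (1 - r) v; rewrite mulrBl mul1r.
  have := nrmD (v - r * v) (r * v); rewrite subrK.
  by have := nrm_ge0 v; nra.
have upper : nrm (\sum_(p <- s) p.1 * (h * v) * p.2) <= M * nrm (h * v).
  apply: le_trans (nrm_sum _ _) _.
  apply: (le_trans (y := \sum_(p <- s) nrm p.1 * nrm p.2 * nrm (h * v))).
    apply: ler_sum => p _; rewrite mulrAC.
    by apply: le_trans (nrmM _ _) _; apply: ler_wpM2r (nrmM _ _); apply: nrm_ge0.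
  by rewrite -mulr_suml /M; have := nrm_ge0 (h * v); nra.
have hv : 1 <= 8 * M * nrm (h * v).
  have := nrmB (\sum_(p <- s) p.1 * (h * v) * p.2)
    (\sum_(p <- s) p.1 * (h * v) * p.2 - r * v).
  by rewrite subKr; lra.
have := hP n v; rewrite -expr2 -exprM => hn.
have := nrmB (T f ^+ (2 * n) * h) (T f ^+ (2 * n) * h - y ^+ (2 * n) * h * v).
have := nrmM_le T_n (lexx (nrm h)); rewrite subKr => le1 le2.
have : 16 * M * ((1 - d) ^+ n / (16 * M)) = (1 - d) ^+ n by rewrite mulrC divfK //; lra.
move: fT d_n hn JP hv; clear - HA M1 le1 le2.
move: ((1 - d) ^+ n / _) => eta; move: ((1 - d) ^+ n) => D fT D0 hn JP hv etaE.
(* After multiplication by [16 * M], the upper bound is below [2 * D] by the choice of [J] and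
   [eta], while [hv] makes the lower bound at least [2 * D]. *)
have : 16 * M * nrm (y ^+ (2 * n) * h * v) <=
    16 * M * ((1 - e) ^+ n * nrm h + eta) by apply: ler_wpM2l; lra.
have : 16 * M * (D * nrm (h * v)) <= 16 * M * nrm (y ^+ (2 * n) * h * v).
  by apply: ler_wpM2l; lra.
by have := ler_wpM2l (ltW D0) hv; lra.
Qed.

Lemma central_compression (F : seq A) e : simple_cstar nrm -> 0 < e ->
  eventually_central (fun f => forall a, a \in F -> nrm a - e < nrm (f * a * f)).
Proof.
move=> simple e0; apply: eventually_central_all => a.
have [a_e|] := ltP (nrm a) e.
  by exists [::], 1; split=> // f _; have := nrm_ge0 (f * a * f); lra.
move=> e_a; have a0 : 0 < nrm a by lra.
(* Normalising [a] divides the tolerance by [nrm a]; halving the quotient keeps it strictly below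
   1. *)
have [e' /andP[e'0 e'1] e'_a] : exists2 e', 0 < e' < 1 & nrm a * e' <= e.
  have q0 : 0 < e / nrm a by rewrite divr_gt0.
  have q1 : e / nrm a <= 1 by rewrite ler_pdivrMr ?mul1r.
  have qa : e / nrm a * nrm a = e by rewrite divfK ?gt_eqF.
  move: q0 q1 qa; move: (e / nrm a) => q q0 q1 qa.
  by exists (q / 2); [apply/andP; split|]; lra.
have [b b1 aE] : exists2 b, nrm b = 1 & a = (nrm a)%:C *: b.
  exists ((nrm a)^-1%:C *: a).
    by rewrite nrmZ ger0_norm ?mulVf ?gt_eqF // invr_ge0 ltW.
  by rewrite scalerA -rmorphM divff ?gt_eqF // rmorph1 scale1r.
have e'01 : 0 < e' < 1 by rewrite e'0.
apply: eventually_central_imp (central_compression_unit simple b1 e'01) => f _ _.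
rewrite [in f * a]aE -scalerAr -scalerAl nrmZ (ger0_norm (ltW a0)) => lt_f.
by have : nrm a * (1 - e') < nrm a * nrm (f * b * f); [rewrite ltr_pM2l|lra].
Qed.

(* Squaring all the [f i] preserves the hypotheses, so [|sum f|^(2^k) <= #|I|]. *)
Lemma nrm_orthogonal_sum_le (I : finType) (f : I -> A) :
  (forall i, st (f i) = f i) -> (forall i, nrm (f i) <= 1) ->
  (forall i j, i != j -> f i * f j = 0) -> nrm (\sum_i f i) <= 1.
Proof.
move=> sf f1 ff.
have bound k g : (forall i, st (g i) = g i) -> (forall i, nrm (g i) <= 1) ->
    (forall i j : I, i != j -> g i * g j = 0) ->
    nrm (\sum_i g i) ^+ (2 ^ k) <= #|I|%:R.
  elim: k g => [|k IH] g sg g1 gg.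
    apply: le_trans (nrm_sum _ _) _; rewrite -sum1_card natr_sum.
    exact: ler_sum.
  rewrite expnS exprM -nrm_sqr ?st_sum; last exact: eq_bigr.
  have -> : (\sum_i g i) * (\sum_i g i) = \sum_i g i * g i.
    rewrite big_distrl /=; apply: eq_bigr => i _; rewrite big_distrr /=.
    by rewrite (bigD1 i) //= big1 ?addr0 // => j ji; rewrite gg // eq_sym.
  apply: IH => [i|i|i j ij]; first by rewrite stM sg.
    by have := nrmM_le (g1 i) (g1 i); rewrite mulr1.
  by rewrite mulrA -(mulrA (g i)) gg // mulr0 mul0r.
rewrite leNgt; apply/negP => /(@exists_pow2_gt _ #|I|%:R) [k].
by rewrite ltNge bound.
Qed.

(** * Rokhlin towers *)

Lemma positiveZ r x : 0 < r -> positive st x -> positive st (r%:C *: x).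
Proof.
move=> r0 [sx xP]; split; first by rewrite stZr sx.
move=> lam lam0; have rC0 : 0 < r%:C by rewrite ltcR.
have [|b [xb bx]] := xP (r%:C^-1 * lam).
  by rewrite pmulr_rge0 ?invr_gt0.
have rE : r%:C *: x - lam *: 1 = r%:C *: (x - (r%:C^-1 * lam) *: 1).
  by rewrite scalerBr scalerA mulrA divff ?mul1r // gt_eqF.
exists (r%:C^-1 *: b); rewrite rE -!scalerAl -!scalerAr !scalerA xb bx.
by rewrite divff ?mulVf ?scale1r // gt_eqF.
Qed.

(** The scalar is absorbed into the implementing sequence through its square root. *)
Lemma cuntz_below_scale r b x : 0 < r ->
  cuntz_below st nrm b (r%:C *: x) -> cuntz_below st nrm b x.
Proof.
move=> r0 [v vb]; exists (fun n => (Num.sqrt r)%:C *: v n) => e /vb [N vN].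
exists N => n /vN; rewrite stZr -!scalerAr -!scalerAl scalerA -rmorphM.
by rewrite -expr2 sqr_sqrtr ?ltW // -scalerAr -scalerAl.
Qed.

Lemma pos_contraction_norm a : pos_contraction st nrm a -> st a = a /\ nrm a <= 1.
Proof. by case=> [[]]. Qed.

Lemma projection_norm p : projection st p -> st p = p /\ nrm p <= 1.
Proof.
case=> sp pp; split=> //; have := nrm_sqr sp; rewrite pp.
have := nrm_ge0 p; nra.
Qed.

Section Equivalence.
Variables (gT : finGroupType) (alpha : gT -> A -> A) (elt : A -> Prop).
(** This common property of positive contractions and projections lets one argument serve both
    versions of the equivalence. *)
Hypothesis eltP : forall a, elt a -> st a = a /\ nrm a <= 1.

Lemma tower_sum F e x f : rokhlin_tower st nrm alpha elt F e x f ->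
  st (\sum_g f g) = \sum_g f g /\ nrm (\sum_g f g) <= 1.
Proof.
case=> fE ff _ _ _; split.
  by rewrite st_sum; apply: eq_bigr => g _; case: (eltP (fE g)).
by apply: nrm_orthogonal_sum_le => // g; case: (eltP (fE g)).
Qed.

Lemma tower_weaken (F F' : seq A) e e' x f : {subset F <= F'} -> e' <= e ->
  rokhlin_tower st nrm alpha elt F' e' x f -> rokhlin_tower st nrm alpha elt F e x f.
Proof.
move=> FF ee [fE ff fF fg fx]; split=> // [g a /FF /(fF g)|g h]; first lra.
by have := fg g h; lra.
Qed.

(** Normalise [x]; since the tower sum [f] is a contraction, [nrm (f * x * f) <= nrm f] for the
    normalised [x]. *)
Lemma rokhlin_def_cond2 : rokhlin_def st nrm alpha elt -> rokhlin_cond2 st nrm alpha elt.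
Proof.
move=> ro F e x e0 px /nrm_gt0 x0.
have x0' : 0 < (nrm x)^-1 by rewrite invr_gt0.
have x1 : nrm ((nrm x)^-1%:C *: x) = 1.
  by rewrite nrmZ ger0_norm ?mulVf ?gt_eqF // ltW.
have [f [fT fx]] := ro F e _ e0 (positiveZ x0' px) x1; exists f.
have [_ f1] := tower_sum fT; split.
  by case: fT => *; split=> //; apply: cuntz_below_scale x0' _.
apply: lt_le_trans fx _; rewrite -[leRHS]mulr1.
apply: nrmM_le f1; rewrite -[leRHS]mulr1; apply: nrmM_le (lexx _) _; by rewrite x1.
Qed.

Lemma rokhlin_cond2_cond3 : simple_cstar nrm ->
  rokhlin_cond2 st nrm alpha elt -> rokhlin_cond3 st nrm alpha elt.
Proof.
move=> simple ro F e x e0 px x0.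
have [F' [e' [e'0 comp]]] := central_compression F simple e0.
have G1 : 1 <= #|gT|%:R :> R by rewrite ler1n; apply/card_gt0P; exists 1%g.
(* Commutators with the tower sum add up over the group, hence the division by its order. *)
pose d := Num.min e (e' / #|gT|%:R).
have d0 : 0 < d by rewrite lt_min e0 divr_gt0 //; lra.
have dG : #|gT|%:R * d <= e'.
  by rewrite mulrC -ler_pdivlMr ?ge_min ?lexx ?orbT //; lra.
have [f [fT f_d]] := ro (F ++ F') d x d0 px x0; exists f; split.
  apply: tower_weaken fT; last by rewrite ge_min lexx.
  by move=> a; rewrite mem_cat => ->.
have [sf f1] := tower_sum fT; apply: comp; split=> //; first nra.
case: fT => _ _ fF _ _ c cF'; rewrite big_distrl big_distrr /= -sumrB.
apply: le_trans (nrm_sum _ _) _; apply: le_trans dG.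
rewrite mulrC mulr_natr -sum1_card -sumrMnr.
by apply: ler_sum => g _; rewrite mulr1n ltW // fF // mem_cat cF' orbT.
Qed.

Lemma rokhlin_cond3_def : rokhlin_cond3 st nrm alpha elt -> rokhlin_def st nrm alpha elt.
Proof.
move=> ro F e x e0 px x1.
have x0 : x <> 0 by move=> x0; move: x1; rewrite x0 nrm0 => /eqP; rewrite eq_sym oner_eq0.
(* Putting [x] itself into the finite set turns the norm condition for [a = x] into the required
   one. *)
have [f [fT fx]] := ro (x :: F) e x e0 px x0; exists f; split.
  by apply: tower_weaken fT => // a aF; rewrite inE aF orbT.
by rewrite -x1; apply: fx; rewrite inE eqxx.
Qed.

Lemma rokhlin_equiv : simple_cstar nrm ->
  (rokhlin_def st nrm alpha elt <-> rokhlin_cond2 st nrm alpha elt) /\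
  (rokhlin_def st nrm alpha elt <-> rokhlin_cond3 st nrm alpha elt).
Proof.
move=> simple; have D2 := rokhlin_def_cond2.
have D3 := rokhlin_cond2_cond3 simple; have D1 := rokhlin_cond3_def.
by split; split; auto.
Qed.

End Equivalence.
End CStarAlgebra.

Theorem theorem1p1 (R : realType) (A : algType R[i]) (st : A -> A) (nrm : A -> R)
  (HA : unital_cstar_algebra st nrm) (Hsimple : simple_cstar nrm)
  (gT : finGroupType) (alpha : gT -> A -> A) (Halpha : group_action st alpha) :
  [/\ weak_tracial_rokhlin st nrm alpha <-> rokhlin_cond2 st nrm alpha (pos_contraction st nrm),
      weak_tracial_rokhlin st nrm alpha <-> rokhlin_cond3 st nrm alpha (pos_contraction st nrm),
      tracial_rokhlin st nrm alpha <-> rokhlin_cond2 st nrm alpha (projection st) &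
      tracial_rokhlin st nrm alpha <-> rokhlin_cond3 st nrm alpha (projection st)].
Proof.
have [w2 w3] := rokhlin_equiv HA alpha (@pos_contraction_norm _ _ st nrm) Hsimple.
by have [p2 p3] := rokhlin_equiv HA alpha (projection_norm HA) Hsimple.
Qed.
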